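(* Let $P$ be a centrally L-bounded poset, and let $e=e(P)$. For every integer $n\ge e+3$, $$\mathrm{La}(n,P)=\Sigma(n,e).$$ Hence, the limit $\pi(P)=\lim_{n\to\infty}\mathrm{La}(n,P)/\binom{n}{\lfloor n/2\rfloor}$ exists and $\pi(P)=e$.
   Context: All posets are finite and nonempty. Let $[n]=\{1,\dots,n\}$; families of subsets of $[n]$ are ordered by inclusion. A poset $(P,\le)$ contains a poset $(P',\le')$ as a (weak) subposet if there is an injection $f:P'\to P$ such that $u\le' v$ implies $f(u)\le f(v)$. A family $\mathcal F\subseteq 2^{[n]}$ is $P$-free if it does not contain $P$ in this sense. $\mathrm{La}(n,P)$ is the largest size of a $P$-free family $\mathcal F\subseteq 2^{[n]}$. $e(P)$ is the maximum integer $k\ge 0$ such that for all integers $n$ and $s$ the family $\binom{[n]}{s}\cup\binom{[n]}{s+1}\cup\cdots\cup\binom{[n]}{s+k-1}$ is $P$-free, where $\binom{[n]}{j}$ is the collection of $j$-element subsets of $[n]$ (empty if $j<0$ or $j>n$). $\Sigma(n,k)=\sum_{i=\lfloor (n-k+1)/2\rfloor}^{\lfloor (n+k-1)/2\rfloor}\binom{n}{i}$ is the number of subsets of $[n]$ in the $k$ middle levels. The Lubell function of $\mathcal F\subseteq 2^{[n]}$ is the average over all $n!$ full (maximal) chains $\mathcal C$ of $2^{[n]}$ of $|\mathcal F\cap\mathcal C|$; equivalently $\bar h_n(\mathcal F)=\sum_{F\in\mathcal F}1/\binom{n}{|F|}$. $P$ is centrally L-bounded if for all $n$, $\bar h_n(\mathcal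 F)\le e(P)$ for every $P$-free family $\mathcal F\subseteq 2^{[n]}$ with $\emptyset,[n]\notin\mathcal F$. *)

(* Defs.v *)
From HB Require Import structures.
From mathcomp Require Import all_boot all_order all_algebra.
From mathcomp Require Import all_classical all_reals all_analysis.

Set Implicit Arguments.
Unset Strict Implicit.
Unset Printing Implicit Defensive.

Import Order.TTheory GRing.Theory Num.Theory.
Import numFieldNormedType.Exports.

(* The ground set [n] is 'I_n, so 2^[n] is {set 'I_n} ordered by \subset. *)

Definition contains_poset (d : Order.disp_t) (P : finPOrderType d) (n : nat)
    (F : {set {set 'I_n}}) : bool :=
  [exists f : {ffun P -> {set 'I_n}},
    [&& injectiveb f,
        [forall u, f u \in F] &
        [forall u, forall v, (u <= v)%O ==> (f u \subset f v)]]].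

Definition poset_free (d : Order.disp_t) (P : finPOrderType d) (n : nat)
    (F : {set {set 'I_n}}) : bool :=
  ~~ contains_poset P F.

Definition La (n : nat) (d : Order.disp_t) (P : finPOrderType d) : nat :=
  \max_(F : {set {set 'I_n}} | poset_free P F) #|F|.

(* Levels s, s + 1, ..., s + k - 1; s is an integer, possibly negative. *)
Definition levels (n : nat) (s : int) (k : nat) : {set {set 'I_n}} :=
  [set A : {set 'I_n} | (s <= #|A|%:Z)%R && (#|A|%:Z < s + k%:Z)%R].

Definition levels_free (d : Order.disp_t) (P : finPOrderType d) (k : nat) :
    Prop :=
  forall (n : nat) (s : int), poset_free P (levels n s k).

Definition is_e (d : Order.disp_t) (P : finPOrderType d) (k : nat) : Prop :=
  levels_free P k /\ forall j : nat, levels_free P j -> j <= k.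

(* The default value 0 is only relevant for empty P, see e_posetP. *)
Definition e_poset (d : Order.disp_t) (P : finPOrderType d) : nat :=
  xget 0 (is_e P).

(* The upper bound is excluded:
   (n + k + 1)./2 = floor((n + k - 1) / 2) + 1 even when n = k = 0, while
   truncation at 0 in the lower bound only drops levels of negative index. *)
Definition Sigma (n k : nat) : nat :=
  \sum_((n.+1 - k)./2 <= i < (n + k).+1./2) 'C(n, i).

Definition is_chain (n : nat) (C : {set {set 'I_n}}) : bool :=
  [forall A in C, forall B in C, (A \subset B) || (B \subset A)].

Definition full_chains (n : nat) : {set {set {set 'I_n}}} :=
  [set C : {set {set 'I_n}} | maxset (@is_chain n) C].

Definition lubell (n : nat) (F : {set {set 'I_n}}) : rat :=
  ((\sum_(C in full_chains n) #|F :&: C|)%N%:R / #|full_chains n|%:R)%R.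

Definition centrally_L_bounded (d : Order.disp_t) (P : finPOrderType d) :
    Prop :=
  forall (n : nat) (F : {set {set 'I_n}}),
    poset_free P F -> finset.set0 \notin F -> [set: 'I_n]%SET \notin F ->
    (lubell F <= (e_poset P)%:R)%R.

Definition La_ratio (R : realType) (d : Order.disp_t) (P : finPOrderType d)
    (n : nat) : R :=
  ((La n P)%:R / 'C(n, n./2)%:R)%R.

Definition pi_poset (R : realType) (d : Order.disp_t) (P : finPOrderType d) :
    R :=
  limn (@La_ratio R d P).

Lemma levels_free_lt (d : Order.disp_t) (P : finPOrderType d) (k : nat) :
  levels_free P k -> k < #|P|.
Proof.
move=> Hk; rewrite ltnNge; apply/negP => leP.
have /negP := Hk #|P| 1%R; apply; apply/existsP.
exists [ffun x : P => [set i : 'I_#|P| | (enum_val i <= x)%O]%SET].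
apply/and3P; split.
- apply/injectiveP => x y; rewrite !ffunE => /setP E.
  have := E (enum_rank x); have := E (enum_rank y).
  rewrite !inE !enum_rankK !lexx => Hyx Hxy.
  by apply/le_anti; rewrite -Hxy Hyx.
- apply/forallP => x; rewrite ffunE inE; set A := finset _.
  have A_gt0 : 0 < #|A|.
    by apply/card_gt0P; exists (enum_rank x); rewrite inE enum_rankK.
  have A_le : #|A| <= #|P| by rewrite -[X in _ <= X]card_ord max_card.
  by rewrite -PoszD lez_nat ltz_nat A_gt0 add1n ltnS (leq_trans A_le).
- apply/forallP => x; apply/forallP => y; apply/implyP => xy.
  by rewrite !ffunE; apply/fintype.subsetP => i; rewrite !inE => /le_trans; apply.
Qed.

Lemma e_posetP (d : Order.disp_t) (P : finPOrderType d) :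
  0 < #|P| -> is_e P (e_poset P).
Proof.
move=> /card_gt0P[p0 _].
have free0 : levels_free P 0.
  move=> n s; apply/negP => /existsP[f /and3P[_ /forallP/(_ p0)]].
  by rewrite inE addr0 => /andP[h1 h2]; move: (le_lt_trans h1 h2); rewrite ltxx.
have exk : exists k, `[< levels_free P k >] by exists 0; apply/asboolP.
have ubk k : `[< levels_free P k >] -> k <= #|P|.
  by move=> /asboolP/levels_free_lt/ltnW.
case: (ex_maxnP exk ubk) => k /asboolP Hk kmax.
by apply: (@xgetPex _ 0 (is_e P)); exists k; split=> // j Hj; apply/kmax/asboolP.
Qed.

(* Main.v *)
(**
Counting full chains gives lubell F = sum over A in F of 1 / 'C(n, |A|): by
symmetry the number of full chains through A depends only on |A|, and a full
chain contains exactly one set of each size.  Among the families with Lubell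
function at most e, the e middle levels are therefore largest, which settles
P-free families that avoid set0 and [n].  If a P-free family contains set0 but
misses some singleton, replacing set0 by that singleton keeps it P-free;
likewise for [n] and the complements of singletons.  If it contains all
singletons (or all their complements), then n units of its size are bought at
Lubell price 1, which would pay for 'C(n, (n + 1 - e) / 2) >= n + 2 sets of the
lowest middle level, and this loss makes up for set0 and [n] (here n >= e + 3
is used).
*)
Require Import Defs.
From mathcomp Require Import all_boot all_order all_algebra perm zify lra.

Set Implicit Arguments.
Unset Strict Implicit.
Unset Printing Implicit Defensive.

Import Order.TTheory GRing.Theory Num.Theory.

Lemma exists_set_between (T : finType) (A B : {set T}) (k : nat) :
  A \subset B -> #|A| <= k <= #|B| ->
  exists D : {set T}, [/\ A \subset D, D \subset B & #|D| = k].
Proof.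
move=> sAB; elim: k => [|k IHk] /andP[leAk lekB].
  by exists A; split=> //; apply/eqP; rewrite -leqn0.
move: leAk; rewrite leq_eqVlt => /predU1P[eqAk|]; first by exists A.
rewrite ltnS => leAk; have [|D [sAD sDB cD]] := IHk.
  by rewrite leAk ltnW.
have /properP[_ [x xB xD]] : D \proper B by rewrite properEcard sDB cD.
exists (x |: D); rewrite subUset sub1set xB sDB cardsU1 xD cD.
by split=> //; apply: subset_trans sAD _; apply: subsetUr.
Qed.

Lemma full_chain_comparable n (C : {set {set 'I_n}}) (D : {set 'I_n}) :
  C \in full_chains n ->
  (forall A, A \in C -> (A \subset D) || (D \subset A)) -> D \in C.
Proof.
rewrite inE => /maxsetP[chC maxC] cmpD.
rewrite -[C](maxC (D |: C)) ?setU11 ?subsetUr //.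
apply/forall_inP => A /setU1P[->|inA]; apply/forall_inP => B /setU1P[->|inB].
- by rewrite subxx.
- by rewrite orbC cmpD.
- exact: cmpD.
- by move/forall_inP: chC => /(_ _ inA)/forall_inP/(_ _ inB).
Qed.

Lemma full_chain_total n (C : {set {set 'I_n}}) (A B : {set 'I_n}) :
  C \in full_chains n -> A \in C -> B \in C -> (A \subset B) || (B \subset A).
Proof.
rewrite inE => /maxsetP[/forall_inP chC _] inA inB.
by have /forall_inP := chC _ inA; apply.
Qed.

Lemma full_chain_subset n (C : {set {set 'I_n}}) (A B : {set 'I_n}) :
  C \in full_chains n -> A \in C -> B \in C -> #|A| <= #|B| -> A \subset B.
Proof.
move=> fC inA inB leAB; case/orP: (full_chain_total fC inA inB) => [|sBA] //.
by have /eqP-> : B == A by rewrite eqEcard sBA.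
Qed.

Lemma full_chain_level n (C : {set {set 'I_n}}) (k : nat) :
  C \in full_chains n -> k <= n -> exists2 D, D \in C & #|D| = k.
Proof.
move=> fC lekn.
have C0 : set0 \in C.
  by apply: (full_chain_comparable fC) => A _; rewrite sub0set orbT.
have CT : [set: 'I_n] \in C.
  by apply: (full_chain_comparable fC) => A _; rewrite subsetT.
have P0 : (set0 \in C) && (#|@set0 'I_n| <= k) by rewrite C0 cards0.
have PT : ([set: 'I_n] \in C) && (k <= #|[set: 'I_n]|).
  by rewrite CT cardsT card_ord.
case: (@arg_maxnP _ _ (fun A : {set 'I_n} => (A \in C) && (#|A| <= k))
         (fun A => #|A|) P0) => A /andP[inA leAk] Amax.
case: (@arg_minnP _ _ (fun A : {set 'I_n} => (A \in C) && (k <= #|A|))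
         (fun A => #|A|) PT) => B /andP[inB lekB] Bmin.
have sAB := full_chain_subset fC inA inB (leq_trans leAk lekB).
have [|D [sAD sDB cD]] := @exists_set_between _ A B k sAB.
  by rewrite leAk.
exists D => //; apply: (full_chain_comparable fC) => X inX.
have [leXk|/ltnW lekX] := leqP #|X| k.
  have := Amax X; rewrite inX leXk => /(_ isT) leXA.
  by rewrite (subset_trans (full_chain_subset fC inX inA leXA) sAD).
have := Bmin X; rewrite inX lekX => /(_ isT) leBX.
by rewrite (subset_trans sDB (full_chain_subset fC inB inX leBX)) orbT.
Qed.

Lemma card_full_chain_level n (C : {set {set 'I_n}}) (k : nat) :
  C \in full_chains n -> k <= n -> #|[set A in C | #|A| == k]| = 1.
Proof.
move=> fC /(full_chain_level fC)[D inD cD]; apply/eqP/cards1P; exists D.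
apply/setP => A; rewrite !inE; apply/andP/eqP => [[inA /eqP cA]|->].
  by apply/eqP; rewrite eqEcard cA cD leqnn (full_chain_subset fC) ?cA ?cD.
by rewrite inD cD.
Qed.

Lemma full_chains_gt0 n : 0 < #|full_chains n|.
Proof.
have ch0 : is_chain (set0 : {set {set 'I_n}}).
  by apply/forall_inP => A; rewrite inE.
have [C maxC _] := maxset_exists ch0.
by apply/card_gt0P; exists C; rewrite inE.
Qed.

Lemma exists_perm_imset (T : finType) (A B : {set T}) :
  #|A| = #|B| -> exists s : {perm T}, s @: A = B.
Proof.
move=> cAB; pose en (D : {set T}) := enum D ++ enum (~: D).
have mem_en D x : x \in en D.
  by rewrite mem_cat !mem_enum inE orbN.
have uniq_en D : uniq (en D).
  rewrite cat_uniq !enum_uniq andbT /=; apply/hasPn => x.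
  by rewrite !mem_enum inE.
have size_en D : size (en D) = #|T| by rewrite size_cat -!cardE cardsC.
pose f x := nth x (en B) (index x (en A)).
have ltf x : index x (en A) < size (en B).
  by rewrite size_en -(size_en A) index_mem.
have f_inj : injective f.
  move=> x y; rewrite /f (set_nth_default y x (ltf x)) => /eqP.
  rewrite nth_uniq // => /eqP exy.
  by rewrite -(nth_index x (mem_en A x)) exy nth_index.
exists (perm f_inj); apply/eqP; rewrite eqEcard card_imset ?cAB ?leqnn ?andbT;
  last exact: perm_inj.
apply/subsetP => _ /imsetP[x xA ->]; rewrite permE /f.
have xe : x \in enum A by rewrite mem_enum.
rewrite /en index_cat xe nth_cat -cardE -cAB cardE index_mem xe.
by rewrite -mem_enum mem_nth // -cardE -cAB cardE index_mem.
Qed.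

Definition chain_image n (s : {perm 'I_n}) (C : {set {set 'I_n}}) :
    {set {set 'I_n}} :=
  [set s @: (A : {set 'I_n}) | A in C].

Lemma chain_imageK n (s t : {perm 'I_n}) :
  cancel s t -> cancel (chain_image s) (chain_image t).
Proof.
move=> sK C; rewrite /chain_image -imset_comp -[RHS]imset_id.
apply: eq_imset => A /=.
by rewrite -imset_comp -[RHS]imset_id; apply: eq_imset => x /=; rewrite sK.
Qed.

Lemma mem_chain_image n (s : {perm 'I_n}) (C : {set {set 'I_n}}) (A : {set 'I_n}) :
  (s @: A \in chain_image s C) = (A \in C).
Proof. by rewrite mem_imset //; apply: imset_inj; apply: perm_inj. Qed.

Lemma chain_image_is_chain n (s : {perm 'I_n}) (C : {set {set 'I_n}}) :
  is_chain C -> is_chain (chain_image s C).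
Proof.
move=> /forall_inP chC; apply/forall_inP => _ /imsetP[A inA ->].
apply/forall_inP => _ /imsetP[B inB ->].
have /forall_inP/(_ _ inB)/orP[sAB|sBA] := chC _ inA.
  by rewrite imsetS.
by rewrite orbC imsetS.
Qed.

Lemma chain_image_full n (s : {perm 'I_n}) (C : {set {set 'I_n}}) :
  C \in full_chains n -> chain_image s C \in full_chains n.
Proof.
rewrite !inE => /maxsetP[chC maxC]; apply/maxsetP.
split=> [|D chD sCD]; first exact: chain_image_is_chain.
have sK : cancel s (s^-1)%g := permK s.
have sVK : cancel (s^-1)%g s := permKV s.
rewrite -[D](chain_imageK sVK) (maxC (chain_image (s^-1)%g D)) //.
  exact: chain_image_is_chain.
by rewrite -[C](chain_imageK sK) imsetS.
Qed.

Definition chains_through n (A : {set 'I_n}) : {set {set {set 'I_n}}} :=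
  [set C in full_chains n | A \in C].

Lemma card_chains_through_le n (A B : {set 'I_n}) :
  #|A| = #|B| -> #|chains_through A| <= #|chains_through B|.
Proof.
move=> /exists_perm_imset[s <-].
rewrite -(card_imset (chains_through A) (can_inj (chain_imageK (permK s)))).
apply: subset_leq_card; apply/subsetP => D /imsetP[C] + ->; rewrite inE.
by case/andP=> fC inA; rewrite inE chain_image_full // mem_chain_image.
Qed.

Lemma card_setI_sum (T : finType) (A B : {set T}) :
  #|A :&: B| = \sum_(x in A) (x \in B).
Proof.
rewrite -sum1_card (eq_bigl (fun x => (x \in A) && (x \in B))).
  by rewrite big_mkcondr; apply: eq_bigr => x _; case: (x \in B).
by move=> x; rewrite inE.
Qed.

Lemma card_chains_throughE n (A : {set 'I_n}) :
  #|chains_through A| = \sum_(C in full_chains n) (A \in C).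
Proof.
transitivity #|full_chains n :&: [set C : {set {set 'I_n}} | A \in C]|.
  by apply: eq_card => C; rewrite !inE.
by rewrite card_setI_sum; apply: eq_bigr => C _; rewrite inE.
Qed.

Lemma card_chains_through n (A : {set 'I_n}) :
  #|chains_through A| * 'C(n, #|A|) = #|full_chains n|.
Proof.
have leAn : #|A| <= n by rewrite -[n in _ <= n]card_ord max_card.
transitivity (\sum_(B : {set 'I_n} | #|B| == #|A|) #|chains_through B|).
  transitivity (\sum_(B : {set 'I_n} | #|B| == #|A|) #|chains_through A|).
    rewrite sum_nat_const mulnC; congr (_ * _).
    have := card_draws 'I_n #|A|; rewrite card_ord => <-.
    by apply: eq_card => B; rewrite inE.
  apply: eq_bigr => B /eqP cB.
  by apply/eqP; rewrite eqn_leq !card_chains_through_le.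
under eq_bigr => B _ do rewrite card_chains_throughE.
rewrite exchange_big /= -[RHS]sum1_card; apply: eq_bigr => C fC.
rewrite -(card_full_chain_level fC leAn).
rewrite (eq_bigl (mem [set B : {set 'I_n} | #|B| == #|A|])).
  by rewrite -card_setI_sum; apply: eq_card => B; rewrite !inE andbC.
by move=> B; rewrite !inE.
Qed.

Lemma lubellE n (F : {set {set 'I_n}}) :
  lubell F = (\sum_(A in F) ('C(n, #|A|)%:R)^-1)%R.
Proof.
have full_neq0 : (#|full_chains n|%:R != 0 :> rat)%R.
  by rewrite pnatr_eq0 -lt0n full_chains_gt0.
rewrite /lubell.
have -> : \sum_(C in full_chains n) #|F :&: C| = \sum_(A in F) #|chains_through A|.
  under eq_bigr => C _ do rewrite card_setI_sum.
  by rewrite exchange_big; apply: eq_bigr => A _; rewrite card_chains_throughE.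
rewrite natr_sum mulr_suml; apply: eq_bigr => A _.
have leAn : #|A| <= n by rewrite -[n in _ <= n]card_ord max_card.
have bin_neq0 : ('C(n, #|A|)%:R != 0 :> rat)%R.
  by rewrite pnatr_eq0 -lt0n bin_gt0.
apply: (mulIf bin_neq0); rewrite mulVf // mulrAC -natrM card_chains_through.
exact: divff.
Qed.

Lemma leq_bin_middle n i j : i <= j -> i + j <= n -> 'C(n, i) <= 'C(n, j).
Proof.
have step m : m.*2 < n -> 'C(n, m) <= 'C(n, m.+1).
  move=> ltmn; rewrite -(@leq_pmul2l m.+1) // mul_bin_left.
  by rewrite leq_mul2r; apply/orP; right; lia.
have half_mono i1 j1 : i1 <= j1 -> j1.*2 <= n -> 'C(n, i1) <= 'C(n, j1).
  move=> /subnKC <-; elim: (j1 - i1) => [|d IHd] lejn; first by rewrite addn0.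
  by rewrite addnS (leq_trans (IHd _) (step _ _)) //; lia.
move=> leij leijn; have [lejn|ltnj] := leqP j.*2 n; first exact: half_mono.
by rewrite -(@bin_sub n j) ?half_mono //; lia.
Qed.

Lemma bin_middle_levels_ge n k i : k <= n ->
  (n.+1 - k)./2 <= i < (n + k).+1./2 -> 'C(n, (n.+1 - k)./2) <= 'C(n, i).
Proof. by move=> lekn /andP[leai ltib]; apply: leq_bin_middle; lia. Qed.

Lemma bin_outer_levels_le n k i : k <= n ->
  ~~ ((n.+1 - k)./2 <= i < (n + k).+1./2) ->
  'C(n, i) <= 'C(n, (n.+1 - k)./2).
Proof.
move=> lekn; rewrite negb_and -ltnNge -leqNgt => /orP[ltia|lebi].
  by apply: leq_bin_middle; lia.
have [lein|ltni] := leqP i n; last by rewrite bin_small.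
by rewrite -bin_sub //; apply: leq_bin_middle; lia.
Qed.

Lemma sum_by_level (V : nmodType) n (f : nat -> V) (a b : nat) :
  (\sum_(A in [set B : {set 'I_n} | (a <= #|B| < b)%N]) f #|A|
   = \sum_(a <= i < b) f i *+ 'C(n, i))%R.
Proof.
transitivity (\sum_(A : {set 'I_n} | (a <= #|A| < b)%N)
                \sum_(a <= i < b | i == #|A|) f i)%R.
  apply: eq_big => A; first by rewrite inE.
  by rewrite inE => ltAb; rewrite big_nat1_eq ltAb.
rewrite (exchange_big_dep xpredT) //= big_nat_cond [RHS]big_nat_cond.
apply: eq_bigr => i; rewrite andbT => leib.
have := card_draws 'I_n i; rewrite card_ord => <-.
rewrite -sumr_const; apply: eq_bigl => A; rewrite inE eq_sym.
by case: eqP => [->|]; rewrite ?leib ?andbF.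
Qed.

Definition middle_levels (n k : nat) : {set {set 'I_n}} :=
  [set A : {set 'I_n} | (n.+1 - k)./2 <= #|A| < (n + k).+1./2].

Lemma card_middle_levels n k : #|middle_levels n k| = Sigma n k.
Proof.
rewrite -sum1_card (sum_by_level _ (fun=> 1)); apply: eq_bigr => i _.
exact: natn.
Qed.

Lemma lubell_middle_levels n k : k <= n -> lubell (middle_levels n k) = k%:R%R.
Proof.
move=> lekn; rewrite lubellE (sum_by_level _ (fun i => ('C(n, i)%:R)^-1)%R).
rewrite big_nat_cond (eq_bigr (fun=> 1%R)) => [|i /andP[/andP[_ ltib] _]].
  rewrite -big_nat_cond sumr_const_nat; congr (_%:R)%R; lia.
by rewrite -[LHS]mulr_natr mulVf // pnatr_eq0 -lt0n bin_gt0; lia.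
Qed.

Lemma middle_levelsE n k : k <= n ->
  middle_levels n k = levels n ((n.+1 - k)./2)%:Z k.
Proof. by move=> lekn; apply/setP => A; rewrite !inE; lia. Qed.

(* Linear programming duality: with the least middle binomial coefficient as
   multiplier t, the reduced cost 1 - t / 'C(n, |A|) is nonnegative on
   the middle levels and nonpositive off them. *)
Lemma card_le_lubell n k (F S : {set {set 'I_n}}) : k <= n ->
  S \subset F -> [disjoint S & middle_levels n k] ->
  (#|F|%:R - 'C(n, (n.+1 - k)./2)%:R * lubell F <=
     (#|S|%:R - 'C(n, (n.+1 - k)./2)%:R * lubell S) +
     ((Sigma n k)%:R - 'C(n, (n.+1 - k)./2)%:R * k%:R))%R.
Proof.
move=> lekn sSF dSM; set t : rat := 'C(n, (n.+1 - k)./2)%:R%R; set M := middle_levels n k in dSM *.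
pose g (A : {set 'I_n}) := (1 - t / 'C(n, #|A|)%:R : rat)%R.
have sum_g (G : {set {set 'I_n}}) :
    (#|G|%:R - t * lubell G = \sum_(A in G) g A)%R.
  by rewrite lubellE mulr_sumr -sumr_const -sumrB.
have bin_pos (A : {set 'I_n}) : (0 < 'C(n, #|A|)%:R :> rat)%R.
  by rewrite ltr0n bin_gt0 -[n in _ <= n]card_ord max_card.
have g_ge0 A : A \in M -> (0 <= g A)%R.
  rewrite inE => MA; rewrite subr_ge0 ler_pdivrMr // mul1r ler_nat.
  exact: bin_middle_levels_ge.
have g_le0 A : A \notin M -> (g A <= 0)%R.
  rewrite inE => MA; rewrite subr_le0 ler_pdivlMr // mul1r ler_nat.
  exact: bin_outer_levels_le.
rewrite -card_middle_levels -(lubell_middle_levels lekn) !sum_g -/M.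
rewrite (big_setID S) /= (setIidPr sSF) lerD2l.
rewrite (big_setID M) /= -[leRHS]addr0 lerD //; last first.
  by apply: sumr_le0 => A /setDP[_ /g_le0].
rewrite [leRHS](big_setID (F :\: S)) /= setIC lerDl.
by apply: sumr_ge0 => A /setDP[/g_ge0].
Qed.

Lemma card_le_Sigma n k (F : {set {set 'I_n}}) : k <= n ->
  (lubell F <= k%:R)%R -> #|F| <= Sigma n k.
Proof.
move=> lekn leFk; rewrite -(ler_nat rat).
have := card_le_lubell lekn (sub0set F); rewrite disjoint_sym.
rewrite -setI_eq0 setI0 eqxx => /(_ isT); set t : rat := 'C(n, (n.+1 - k)./2)%:R%R.
rewrite cards0 [lubell set0]lubellE big_set0.
have : (t * lubell F <= t * k%:R)%R by rewrite ler_wpM2l.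
lra.
Qed.

Lemma card_le_Sigma_level n k j (F : {set {set 'I_n}}) : k <= n -> j <= n ->
  ~~ ((n.+1 - k)./2 <= j < (n + k).+1./2) ->
  (forall A : {set 'I_n}, #|A| = j -> A \in F) -> (lubell F <= k%:R)%R ->
  #|F| + 'C(n, (n.+1 - k)./2) <= Sigma n k + 'C(n, j).
Proof.
move=> lekn lejn out_j Fj leFk; rewrite -(ler_nat rat) !natrD.
pose S := [set A : {set 'I_n} | j <= #|A| < j.+1].
have sSF : S \subset F.
  by apply/subsetP => A; rewrite inE ltnS -eqn_leq eq_sym => /eqP/Fj.
have dSM : [disjoint S & middle_levels n k].
  rewrite -setI_eq0; apply/eqP/setP => A; rewrite !inE.
  apply/negbTE/negP => /andP[jA MA]; have cA : #|A| = j by lia.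
  by move: out_j; rewrite -cA MA.
have := card_le_lubell lekn sSF dSM; set t : rat := 'C(n, (n.+1 - k)./2)%:R%R.
have -> : lubell S = 1%R.
  rewrite lubellE (sum_by_level _ (fun i => ('C(n, i)%:R)^-1)%R) big_nat1.
  by rewrite -[LHS]mulr_natr mulVf // pnatr_eq0 -lt0n bin_gt0.
have -> : #|S| = 'C(n, j).
  by rewrite -sum1_card (sum_by_level _ (fun=> 1)) big_nat1 /= -[RHS]natn.
have : (t * lubell F <= t * k%:R)%R by rewrite ler_wpM2l.
lra.
Qed.

Lemma lubell_level_ge1 n j (F : {set {set 'I_n}}) : j <= n ->
  (forall A : {set 'I_n}, #|A| = j -> A \in F) -> (1 <= lubell F)%R.
Proof.
move=> lejn Fj; pose S := [set A : {set 'I_n} | j <= #|A| < j.+1].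
have sSF : S \subset F.
  by apply/subsetP => A; rewrite inE ltnS -eqn_leq eq_sym => /eqP/Fj.
rewrite lubellE (big_setID S) /= (setIidPr sSF).
rewrite (sum_by_level _ (fun i => ('C(n, i)%:R)^-1)%R) big_nat1.
rewrite -[X in (X + _)%R]mulr_natr mulVf ?pnatr_eq0 -?lt0n ?bin_gt0 // lerDl.
by apply: sumr_ge0 => A _; rewrite invr_ge0.
Qed.

Lemma poset_freeS d (P : finPOrderType d) n (F G : {set {set 'I_n}}) :
  G \subset F -> poset_free P F -> poset_free P G.
Proof.
move=> /subsetP sGF; apply: contra => /existsP[f /and3P[f_inj /forallP fG f_mono]].
by apply/existsP; exists f; rewrite f_inj f_mono andbT; apply/forallP => u; apply/sGF.
Qed.

Lemma poset_free_swap d (P : finPOrderType d) n (F : {set {set 'I_n}})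
    (A B : {set 'I_n}) : A \in F -> B \notin F ->
  (forall X, X \in F -> X != A -> B \subset X -> A \subset X) ->
  (forall X, X \in F -> X != A -> X \subset B -> X \subset A) ->
  poset_free P F -> poset_free P (B |: F :\ A).
Proof.
move=> inA notB upB downB; apply: contra.
move=> /existsP[f /and3P[/injectiveP f_inj /forallP fF f_mono]].
have f_neqB u : f u != B -> (f u != A) && (f u \in F).
  by move=> neB; have := fF u; rewrite !inE (negbTE neB).
pose g := [ffun u => if f u == B then A else f u].
apply/existsP; exists g; apply/and3P; split.
- apply/injectiveP => u v; rewrite !ffunE.
  case: eqVneq => [fuB|/f_neqB/andP[fuA _]]; case: eqVneq => [fvB|/f_neqB/andP[fvA _]].
  + by move=> _; apply: f_inj; rewrite fuB.
  + by move=> eA; rewrite -eA eqxx in fvA.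
  + by move=> eA; rewrite eA eqxx in fuA.
  + exact: f_inj.
- by apply/forallP => u; rewrite ffunE; case: eqVneq => // /f_neqB/andP[].
apply/forallP => u; apply/forallP => v; apply/implyP => leuv.
have := forallP (forallP f_mono u) v; rewrite leuv /= !ffunE.
case: eqVneq => [->|/f_neqB/andP[fuA fuF]]; case: eqVneq => [->|/f_neqB/andP[fvA fvF]] //.
- exact: upB.
- exact: downB.
Qed.

Lemma poset_free_swap_card d (P : finPOrderType d) n (F : {set {set 'I_n}})
    (A B : {set 'I_n}) : B \notin F -> A != B ->
  (forall X, X \in F -> X != A -> B \subset X -> A \subset X) ->
  (forall X, X \in F -> X != A -> X \subset B -> X \subset A) ->
  poset_free P F ->
  exists G : {set {set 'I_n}}, [/\ poset_free P G, #|G| = #|F|, A \notin G &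
    forall X, X != A -> X != B -> (X \in G) = (X \in F)].
Proof.
move=> notB neAB upB downB freeF.
have [inA|notA] := boolP (A \in F); last by exists F.
exists (B |: F :\ A); split; first exact: poset_free_swap.
- by rewrite cardsU1 !inE (negbTE notB) andbF (cardsD1 A F) inA.
- by rewrite !inE eqxx (negbTE neAB).
- by move=> X neA neB; rewrite !inE neA (negbTE neB).
Qed.

Lemma full_level_upper_bound d (P : finPOrderType d) n
    (F : {set {set 'I_n}}) j :
  centrally_L_bounded P -> e_poset P + 3 <= n -> j = 1 \/ j = n.-1 ->
  (forall A : {set 'I_n}, #|A| = j -> A \in F) ->
  poset_free P F -> #|F| <= Sigma n (e_poset P).
Proof.
move=> hP lt_en j_def Fj freeF; have lekn : e_poset P <= n by lia.
pose G := F :\ set0 :\ [set: 'I_n].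
have leFG : #|F| <= #|G| + 2.
  rewrite /G (cardsD1 set0 F) (cardsD1 [set: 'I_n] (F :\ set0)).
  rewrite addnA addnC leq_add2l; exact: leq_add (leq_b1 _) (leq_b1 _).
apply: (leq_trans leFG).
have lejn : j <= n by lia.
have Gj (A : {set 'I_n}) : #|A| = j -> A \in G.
  move=> cA; rewrite !inE Fj // andbT -[A == set0]cards_eq0 eqEcard.
  by rewrite subsetT cardsT card_ord cA; lia.
have lubG : (lubell G <= (e_poset P)%:R)%R.
  apply: hP; rewrite ?inE ?eqxx ?andbF //.
  by apply: poset_freeS freeF; apply: subset_trans (subD1set _ _) (subD1set _ _).
have e_gt0 : 0 < e_poset P.
  by rewrite -(ltr_nat rat) (lt_le_trans ltr01) // (le_trans (lubell_level_ge1 lejn Gj)).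
have out_j : ~~ ((n.+1 - e_poset P)./2 <= j < (n + e_poset P).+1./2) by lia.
have := card_le_Sigma_level lekn lejn out_j Gj lubG.
have -> : 'C(n, j) = n.
  case: j_def => ->; first exact: bin1.
  by rewrite -[n in RHS]bin1 -[n.-1]subn1 bin_sub //; lia.
suff : n + 2 <= 'C(n, (n.+1 - e_poset P)./2) by lia.
have le2 : 'C(n, 2) <= 'C(n, (n.+1 - e_poset P)./2) by apply: leq_bin_middle; lia.
apply: leq_trans le2; rewrite bin2; nia.
Qed.

Lemma La_upper_bound d (P : finPOrderType d) n (F : {set {set 'I_n}}) :
  centrally_L_bounded P -> e_poset P + 3 <= n ->
  poset_free P F -> #|F| <= Sigma n (e_poset P).
Proof.
move=> hP lt_en freeF; have lekn : e_poset P <= n by lia.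
have [/forallP full1|] := boolP [forall A : {set 'I_n}, (#|A| == 1) ==> (A \in F)].
  apply: (@full_level_upper_bound _ P _ F 1) => //; first by left.
  by move=> A /eqP cA; have := full1 A; rewrite cA.
case/forallPn => A; rewrite negb_imply => /andP[/eqP cA notA].
have [/forallP fulln|] :=
    boolP [forall B : {set 'I_n}, (#|B| == n.-1) ==> (B \in F)].
  apply: (@full_level_upper_bound _ P _ F n.-1) => //; first by right.
  by move=> B /eqP cB; have := fulln B; rewrite cB.
case/forallPn => B; rewrite negb_imply => /andP[/eqP cB notB].
have neq_card (X Y : {set 'I_n}) : #|X| != #|Y| -> X != Y.
  by apply: contra_neq => ->.
have c0 : #|@set0 'I_n| = 0 by exact: cards0.
have cT : #|[set: 'I_n]| = n by rewrite cardsT card_ord.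
have [|X _ _ _|X XF neX sXA|G [freeG cG G0 GE]] :=
    poset_free_swap_card notA (neq_card set0 A _) _ _ freeF.
- by rewrite c0 cA.
- exact: sub0set.
- have /cards1P[x Ax] : #|A| == 1 by rewrite cA.
  move: sXA notA; rewrite Ax subset1 (negbTE neX) orbF => /eqP <-.
  by rewrite XF.
have notBG : B \notin G by rewrite GE // neq_card // ?c0 ?cA cB; lia.
have [|X XG neX sBX|X _ _ _|H [freeH cH HT HE]] :=
    poset_free_swap_card notBG (neq_card [set: 'I_n] B _) _ _ freeG.
- by rewrite cT cB; lia.
- move: neX; rewrite -properT properEcard subsetT cT /= => ltXn.
  have /eqP eBX : B == X by rewrite eqEcard sBX cB -ltnS (ltn_predK ltXn).
  by rewrite eBX XG in notBG.
- exact: subsetT.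
rewrite -cG -cH; apply: card_le_Sigma => //; apply: hP => //.
by rewrite HE // neq_card // c0 ?cT ?cB; lia.
Qed.

Lemma La_lower_bound d (P : finPOrderType d) n : 0 < #|P| ->
  e_poset P <= n -> Sigma n (e_poset P) <= La n P.
Proof.
move=> /e_posetP[free_e _] lekn; rewrite -card_middle_levels middle_levelsE //.
exact: leq_bigmax_cond.
Qed.

Lemma La_eq_Sigma d (P : finPOrderType d) n : 0 < #|P| ->
  centrally_L_bounded P -> e_poset P + 3 <= n -> La n P = Sigma n (e_poset P).
Proof.
move=> P0 hP lt_en; apply/eqP; rewrite eqn_leq La_lower_bound ?andbT //; last lia.
by apply/bigmax_leqP => F; apply: La_upper_bound.
Qed.

(* Consecutive binomial coefficients d steps below the middle differ by a
   fraction O(d / n) of the middle one, and these differences add up. *)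
Lemma bin_near_middle n d :
  n.+1 * 'C(n, n./2) <= n.+1 * 'C(n, n./2 - d) + 2 * d * d.+1 * 'C(n, n./2).
Proof.
elim: d => [|d IHd]; first by rewrite subn0 leq_addr.
have [led|ltd] := leqP n./2 d.
  have e0 : n./2 - d.+1 = n./2 - d by lia.
  by rewrite e0 (leq_trans IHd) // leq_add2l leq_mul2r; apply/orP; right; nia.
set i := n./2 - d.+1; have ei : n./2 - d = i.+1 by lia.
rewrite ei in IHd.
have lei : 'C(n, i) <= 'C(n, i.+1) by apply: leq_bin_middle; lia.
have leM : 'C(n, i.+1) <= 'C(n, n./2) by apply: leq_bin_middle; lia.
have rec := mul_bin_left n i.
suff : n.+1 * 'C(n, i.+1) <= n.+1 * 'C(n, i) + 4 * d.+1 * 'C(n, n./2) by nia.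
have h1 : n.+1 <= 2 * (n - i) by lia.
have h2 : n - i <= i.+1 + 2 * d.+1 by lia.
have : (n - i) * ('C(n, i.+1) - 'C(n, i)) <= 2 * d.+1 * 'C(n, n./2).
  rewrite mulnBr -rec -mulnBl leq_mul //; lia.
have : n.+1 * ('C(n, i.+1) - 'C(n, i)) <=
       2 * (n - i) * ('C(n, i.+1) - 'C(n, i)) by rewrite leq_mul2r h1 orbT.
rewrite mulnBr; lia.
Qed.

Lemma Sigma_le n k : k <= n -> Sigma n k <= k * 'C(n, n./2).
Proof.
move=> lekn; apply: (@leq_trans (\sum_((n.+1 - k)./2 <= i < (n + k).+1./2) 'C(n, n./2))).
  apply: leq_sum => i _; have [|lti] := leqP i n./2.
    by move=> lei; apply: leq_bin_middle; lia.
  have [lein|ltni] := leqP i n; last by rewrite bin_small.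
  by rewrite -bin_sub //; apply: leq_bin_middle; lia.
rewrite sum_nat_const_nat leq_mul2r; apply/orP; right; lia.
Qed.

Lemma Sigma_ge n k : k <= n -> k * 'C(n, n./2 - k) <= Sigma n k.
Proof.
move=> lekn; apply: (@leq_trans (\sum_((n.+1 - k)./2 <= i < (n + k).+1./2) 'C(n, n./2 - k))).
  rewrite sum_nat_const_nat leq_mul2r; apply/orP; right; lia.
rewrite big_nat_cond [leqRHS]big_nat_cond.
by apply: leq_sum => i /andP[/andP[lei lti] _]; apply: leq_bin_middle; lia.
Qed.

(* Imported only here because classical_sets shadows the names of finset. *)
From mathcomp Require Import all_classical all_reals all_analysis.
Import numFieldNormedType.Exports.

Lemma Sigma_ratio_cvg (R : realType) (k : nat) :
  ((fun n => (Sigma n k)%:R / 'C(n, n./2)%:R : R) @ \oo --> (k%:R : R))%R%classic.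
Proof.
pose K : R := (k * (2 * k * k.+1))%:R%R.
apply: (@squeeze_cvgr _ _ _ _ (fun n => k%:R - K * harmonic n)%R (fun=> k%:R)%R);
  last exact: cvg_cst.
  near=> n; have lekn : k <= n by near: n; exact: nbhs_infty_ge.
  have bin_pos : (0 < 'C(n, n./2)%:R :> R)%R by rewrite ltr0n bin_gt0; lia.
  rewrite ler_pdivrMr // -natrM ler_nat Sigma_le // andbT.
  rewrite ler_pdivlMr // /harmonic.
  have n1_pos : (0 < n.+1%:R :> R)%R by rewrite ltr0n.
  rewrite -(ler_pM2l n1_pos) mulrA mulrBr mulrCA divff ?gt_eqF // mulr1.
  rewrite mulrBl lerBlDr /K -!natrM -natrD ler_nat.
  have := Sigma_ge lekn; have := bin_near_middle n k; nia.
rewrite -[X in (_ --> X)%classic]subr0.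
apply: cvgB; first exact: cvg_cst.
rewrite -(mulr0 K); apply: cvgM; first exact: cvg_cst.
exact: cvg_harmonic.
Unshelve. all: by end_near.
Qed.

Theorem theorem3p2 (R : realType) (d : Order.disp_t) (P : finPOrderType d)
    (P_nonempty : 0 < #|P|) (hP : centrally_L_bounded P) :
  (forall n : nat, e_poset P + 3 <= n -> La n P = Sigma n (e_poset P)) /\
  (cvgn (@La_ratio R d P) /\ pi_poset R P = ((e_poset P)%:R)%R).
Proof.
have LaE n : e_poset P + 3 <= n -> La n P = Sigma n (e_poset P).
  exact: La_eq_Sigma.
split=> //.
have cvgLa : (@La_ratio R d P @ \oo --> ((e_poset P)%:R : R)%R)%classic.
  apply: cvg_trans; last exact: Sigma_ratio_cvg.
  apply: near_eq_cvg; near=> n; rewrite /La_ratio LaE //.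
  by near: n; exact: nbhs_infty_ge.
by split; [apply/cvg_ex; eexists; exact: cvgLa | exact: cvg_lim cvgLa].
Unshelve. all: by end_near.
Qed.
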